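(* Let $\beta>0$ and let $G$ be a connected $(n,\beta)$-graph. Then $t(G)\ge\frac{1-\beta}{\beta}$.
   Context: All graphs are finite, simple and nonempty. The toughness $t(G)$ of a connected graph $G$ is the minimum of $\frac{|S|}{c(G-S)}$ over all proper subsets $S\subset V(G)$ with $G-S$ disconnected, where $c(G-S)$ is the number of components of $G-S$; the toughness of a complete graph is $\infty$. For vertex sets $X,Y$, $e(X,Y)$ is the number of edges with one end in $X$ and the other in $Y$ (edges with both ends in $X\cap Y$ counted twice). A graph on $n$ vertices is an $(n,\beta)$-graph if $\frac{|X||Y|}{(n-|X|)(n-|Y|)}\le\beta^2$ for every pair of (not necessarily disjoint) proper subsets $X,Y$ of $V(G)$ with $e(X,Y)=0$. By convention $K_n$ is an $(n,\beta)$-graph for every $\beta>0$. *)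

(* Defs.v *)
From mathcomp Require Import all_boot all_order all_algebra.
From mathcomp Require Import constructive_ereal reals.
Set Implicit Arguments.
Unset Strict Implicit.
Unset Printing Implicit Defensive.
Import Order.TTheory GRing.Theory Num.Theory.
Local Open Scope ring_scope.

(* A graph is a finite vertex type T with an adjacency relation adj : rel T. *)

Definition simple_graph (T : finType) (adj : rel T) : Prop :=
  symmetric adj /\ irreflexive adj.

Definition connected_graph (T : finType) (adj : rel T) : Prop :=
  forall x y : T, connect adj x y.

Definition complete_graph (T : finType) (adj : rel T) : Prop :=
  forall x y : T, x != y -> adj x y.

(* Adjacency in G - S, kept on the type T: the vertices of S become isolated,
   and are excluded by counting only the components that lie in ~: S. *)
Definition del_adj (T : finType) (adj : rel T) (S : {set T}) : rel T :=
  [rel x y | [&& x \notin S, y \notin S & adj x y]].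

Definition num_comp (T : finType) (adj : rel T) (S : {set T}) : nat :=
  n_comp (del_adj adj S) (~: S).

Definition disconnects (T : finType) (adj : rel T) (S : {set T}) : bool :=
  (1 < num_comp adj S)%N.

(* A connected graph has no disconnecting S exactly when it is complete; the
   minimum is then over the empty family, giving the conventional +oo. *)
Definition toughness (R : realType) (T : finType) (adj : rel T) : \bar R :=
  \big[Order.min/+oo%E]_(S : {set T} | (S \proper [set: T]) && disconnects adj S)
    ((#|S|%:R / (num_comp adj S)%:R)%:E : \bar R).

(* Counting ordered pairs in X x Y counts an edge inside X :&: Y twice and any
   other edge between X and Y once. *)
Definition num_edges (T : finType) (adj : rel T) (X Y : {set T}) : nat :=
  #|[set p in setX X Y | adj p.1 p.2]|.

(* The first disjunct is a genuine convention: for 1 < n and X = Y = {v} the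
   inequality fails on K_n as soon as beta < 1 / (n - 1). *)
Definition nbeta_graph (R : realType) (n : nat) (beta : R)
    (T : finType) (adj : rel T) : Prop :=
  #|T| = n /\
  ((0 < beta /\ complete_graph adj) \/
   forall X Y : {set T}, X \proper [set: T] -> Y \proper [set: T] ->
     num_edges adj X Y = 0%N ->
     (#|X|%:R * #|Y|%:R) / ((n%:R - #|X|%:R) * (n%:R - #|Y|%:R))
       <= beta ^+ 2).

(* Main.v *)
Require Import Defs.
From mathcomp Require Import all_boot all_order all_algebra.
From mathcomp Require Import constructive_ereal reals.
From mathcomp Require Import zify ring lra.
Set Implicit Arguments.
Unset Strict Implicit.
Unset Printing Implicit Defensive.
Import Order.TTheory GRing.Theory Num.Theory.
Local Open Scope ring_scope.

(* Let S disconnect G, with s = |S| and c components in G - S; the claim reads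
   c <= beta (s + c).  If |V - S| <= 2c, take X = Y a transversal of the
   components.  Otherwise, either the components split into two unions X, Y
   with at least c vertices each, or all components but one are singletons, and
   then X = V - S and Y = the set of those singletons work. *)

(** * Balanced splittings of a weighted finite set *)

(** Applied with [P] the components and [a] their sizes. Without a splitting, no subset of [P] has
    weight between [#|P|] and [w P - #|P|]. Comparing two maximal sets below this window forces all
    weights but one to be small. *)
Lemma split_or_giant (I : finType) (P : {set I}) (a : I -> nat) :
  (forall i, i \in P -> 0 < a i)%N -> (2 * #|P| < \sum_(i in P) a i)%N ->
  (exists2 A : {set I}, A \subset P &
     (#|P| <= \sum_(i in A) a i)%N && (#|P| <= \sum_(i in P :\: A) a i)%N) \/
  (exists2 g, g \in P & forall i, i \in P :\ g -> a i = 1%N).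
Proof.
move=> a_gt0 sumP.
pose w (A : {set I}) := (\sum_(i in A) a i)%N.
case: (boolP [exists A : {set I},
  [&& A \subset P, #|P| <= w A & #|P| <= w (P :\: A)]]%N).
  by move=> /existsP[A /and3P[sAP h1 h2]]; left; exists A => //; apply/andP.
move=> /existsPn no_split; right.
have wD (A : {set I}) : A \subset P -> (w A + w (P :\: A) = w P)%N.
  move=> sAP; rewrite /w [in RHS](big_setID A) /=.
  by move/setIidPr: sAP => ->.
have w1 i (A : {set I}) : i \notin A -> w (i |: A) = (a i + w A)%N.
  by move=> iA; rewrite /w big_setU1.
have split_light (A : {set I}) :
    A \subset P -> (#|P| <= w A)%N -> (w (P :\: A) < #|P|)%N.
  by move=> sAP hA; have := no_split A; rewrite sAP hA /= -ltnNge.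
pose light := [pred A : {set I} | (A \subset P) && (w A < #|P|)%N].
pose Sm := [set i in P | a i <= 2]%N.
(* One more element lifts a maximal light set over the window, so what remains is light. *)
have max_add B i : maxset light B -> i \in P -> i \notin B ->
    (w (P :\: (i |: B)) < #|P|)%N.
  move=> /maxsetP[/andP[sBP _] Bmax] iP iB.
  have siBP : i |: B \subset P by rewrite subUset sub1set iP.
  apply: split_light => //; rewrite leqNgt; apply/negP => lt_w.
  have /Bmax : light (i |: B) by rewrite /= siBP.
  by move=> /(_ (subsetUr _ _)) eB; move: iB; rewrite -eB setU11.
(* Adding a weight at most 2 to a light set cannot make it jump over the
   forbidden window, whose width exceeds 2. *)
have sSm B : maxset light B -> Sm \subset B.
  move=> mB; apply/subsetP => i; rewrite inE => /andP[iP ai2].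
  apply/negPn/negP => iB; have := max_add _ _ mB iP iB.
  have /andP[sBP ltB] := maxsetp mB.
  have siBP : i |: B \subset P by rewrite subUset sub1set iP.
  by have := wD _ siBP; rewrite w1 // -/(w P) in sumP *; lia.
(* Elements of [Sm] weigh at least 1 and all others at least 3, so [w B] is at least
   [3 * #|B| - 2 * #|Sm|]. *)
have w_bound B : maxset light B -> (3 * #|B| <= #|P|.-1 + 2 * #|Sm|)%N.
  move=> mB; have /andP[sBP ltB] := maxsetp mB.
  have -> : #|Sm| = (\sum_(i in B) (i \in Sm))%N.
    rewrite -big_mkcondr sum1_card; apply: eq_card => i.
    apply/idP/andP => [iS|[]//].
    by split=> //; apply: (subsetP (sSm _ mB)).
  suff : (3 * #|B| <= w B + 2 * \sum_(i in B) (i \in Sm))%N by lia.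
  rewrite -sum1_card !big_distrr /= -big_split /=.
  apply: leq_sum => i iB; rewrite inE (subsetP sBP) //=.
  by have := a_gt0 _ (subsetP sBP _ iB); lia.
have P_gt0 : (0 < #|P|)%N.
  rewrite lt0n cards_eq0; apply: contraTneq sumP => ->.
  by rewrite big_set0 cards0.
have light0 : light set0 by rewrite /= sub0set /w big_set0.
have [B mB _] := maxset_exists light0.
have /andP[sBP ltB] := maxsetp mB.
have /set0Pn[g] : P :\: B != set0.
  apply/negP => /eqP PB0; have := wD _ sBP; rewrite PB0 {2}/w big_set0 /w.
  by rewrite /w in ltB; lia.
rewrite inE => /andP[gB gP].
have sgBP : g |: B \subset P by rewrite subUset sub1set gP.
have lightK : light (P :\: (g |: B)) by rewrite /= subsetDl max_add.
(* [B] and [K] together cover [P] except possibly [g], and both contain [Sm]. *)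
have [K mK sK] := maxset_exists lightK.
have leK : (#|P :\: (g |: B)| + #|Sm| <= #|K|)%N.
  have -> : (#|P :\: (g |: B)| + #|Sm| = #|(P :\: (g |: B)) :|: Sm|)%N.
    rewrite cardsU (_ : _ :&: _ = set0) ?cards0 ?subn0 //.
    apply/setP => i; rewrite !inE; apply/negP => /andP[/andP[ngB _] iS].
    move: ngB; rewrite (subsetP (sSm _ mB)) ?orbT //.
    by rewrite inE.
  by apply: subset_leq_card; rewrite subUset sK sSm.
have := cardsD1 g P; rewrite gP => cP.
have sBPg : B \subset P :\ g by rewrite subsetD1 sBP.
have leSB := subset_leq_card (sSm _ mB).
have cK : (#|P :\: (g |: B)| = #|P| - #|B|.+1)%N.
  by rewrite cardsD (setIidPr sgBP) cardsU1 gB.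
have leB := subset_leq_card sBPg.
(* Adding [w_bound] for [B] and [K] and using [leK] gives [#|P| - 1 <= #|Sm| <= #|B|]. *)
have eB : B = P :\ g.
  apply/eqP; rewrite eqEcard sBPg /=.
  by have := w_bound _ mB; have := w_bound _ mK; lia.
exists g => // i; rewrite -eB => iB.
have ai := a_gt0 _ (subsetP sBP _ iB).
(* Since [w B < #|P| = #|B| + 1] and every weight is positive, no weight in [B] exceeds 1. *)
have : (#|B :\ i| <= w (B :\ i))%N.
  rewrite -sum1_card /w; apply: leq_sum => j; rewrite !inE => /andP[_ jB].
  exact: a_gt0 (subsetP sBP _ jB).
have := cardsD1 i B; rewrite iB.
have : w B = (a i + w (B :\ i))%N by rewrite /w (big_setD1 i).
by rewrite -eB in cP; lia.
Qed.

(** * Components of [G - S] and pairs of sets without edges *)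

Lemma num_edges0 (T : finType) (adj : rel T) (X Y : {set T}) :
  (forall x y, x \in X -> y \in Y -> ~~ adj x y) -> num_edges adj X Y = 0%N.
Proof.
move=> h; apply/eqP; rewrite cards_eq0; apply/eqP/setP => -[x y].
rewrite !inE /=; apply/negP => /andP[/andP[xX yY]].
exact/negP/h.
Qed.

Section Components.

Variables (T : finType) (adj : rel T) (S : {set T}).
Hypothesis adj_simple : simple_graph adj.

Local Notation e := (del_adj adj S).

(** A transversal of the components of [G - S]: the canonical root of each. *)
Definition comp_reps : {set T} := [set x in ~: S | roots e x].

(** A union of components, indexed by their roots; members of [A] that are not roots outside [S]
    contribute nothing. *)
Definition comps_of (A : {set T}) : {set T} := [set x in ~: S | fingraph.root e x \in A].

Lemma del_adj_connect_sym : connect_sym e.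
Proof.
apply: sym_connect_sym => x y /=.
by rewrite /del_adj /= (proj1 adj_simple) andbCA.
Qed.

Lemma num_compE : num_comp adj S = #|comp_reps|.
Proof. by apply: eq_card => x; rewrite !inE andbC. Qed.

Lemma root_adj x y : x \notin S -> y \notin S -> adj x y ->
  fingraph.root e x = fingraph.root e y.
Proof.
move=> xS yS xy; apply/(fingraph.rootP del_adj_connect_sym)/connect1.
by rewrite /del_adj /= xS yS.
Qed.

Lemma connect_del x y : connect e x y -> x \notin S -> y \notin S.
Proof.
move=> /connectP[p]; elim: p x => [|z p IH] x /=; first by move=> _ ->.
by move=> /andP[/and3P[_ zS _] ep] ey _; apply: (IH z).
Qed.

Lemma root_comp_reps x : x \notin S -> fingraph.root e x \in comp_reps.
Proof.
move=> xS; rewrite !inE (roots_root del_adj_connect_sym) andbT.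
exact: connect_del (connect_root _ x) xS.
Qed.

Lemma card_comps_of (A : {set T}) :
  #|comps_of A| = (\sum_(r in A) #|comps_of [set r]|)%N.
Proof.
rewrite -sum1_card (partition_big (fingraph.root e) (mem A)) /=.
  apply: eq_bigr => r rA; rewrite -sum1_card; apply: eq_bigl => x.
  by rewrite !inE -andbA; case: eqP => [->|]; rewrite ?rA ?andbF.
by move=> x; rewrite inE => /andP[].
Qed.

Lemma comps_of_reps : comps_of comp_reps = ~: S.
Proof.
apply/setP => x; rewrite inE andb_idr // inE.
exact: root_comp_reps.
Qed.

Lemma comp_gt0 r : r \in comp_reps -> (0 < #|comps_of [set r]|)%N.
Proof.
move=> rP; apply/card_gt0P; exists r; move: rP; rewrite !inE.
by case/andP=> -> /eqP ->; rewrite eqxx.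
Qed.

Lemma comps_of_no_edge (A B : {set T}) x y : [disjoint A & B] ->
  x \in comps_of A -> y \in comps_of B -> ~~ adj x y.
Proof.
move=> dAB; rewrite !inE => /andP[xS xA] /andP[yS yB].
apply/negP => /(root_adj xS yS) exy.
by move: yB; rewrite -exy (disjointFr dAB).
Qed.

Lemma reps_no_edge x y : x \in comp_reps -> y \in comp_reps -> ~~ adj x y.
Proof.
rewrite !inE => /andP[xS /eqP rx] /andP[yS /eqP ry].
apply/negP => xy; have := root_adj xS yS xy; rewrite rx ry => exy.
by move: xy; rewrite exy (proj2 adj_simple).
Qed.

(** A neighbour of [y] outside [S] would share its one-vertex component, hence be [y] itself. Here
    [x] ranges over all of [~: S], so the two sets may overlap. *)
Lemma singletons_no_edge (A : {set T}) x y :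
  (forall r, r \in A -> #|comps_of [set r]| = 1%N) ->
  x \in ~: S -> y \in comps_of A -> ~~ adj x y.
Proof.
move=> A1 xS; rewrite !inE in xS * => /andP[yS yA].
apply/negP => xy; have exy := root_adj xS yS xy.
have /eqP/cards1P[z ez] := A1 _ yA.
have : x \in comps_of [set fingraph.root e y] by rewrite !inE xS exy eqxx.
have : y \in comps_of [set fingraph.root e y] by rewrite !inE yS eqxx.
rewrite ez !inE => /eqP yz /eqP xz.
by move: xy; rewrite xz yz (proj2 adj_simple).
Qed.

End Components.

Lemma disconnects_not_complete (T : finType) (adj : rel T) (S : {set T}) :
  simple_graph adj -> disconnects adj S -> ~ complete_graph adj.
Proof.
move=> sG; rewrite /disconnects num_compE => /card_gt1P[x [y [xP yP nxy]]] cG.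
by have := reps_no_edge sG xP yP; rewrite cG.
Qed.

(** For empty [S], [del_adj] is [adj] itself, and connectedness leaves a single root. *)
Lemma disconnects_gt0 (T : finType) (adj : rel T) (S : {set T}) :
  simple_graph adj -> connected_graph adj -> disconnects adj S -> (0 < #|S|)%N.
Proof.
move=> sG cG; rewrite /disconnects num_compE => /card_gt1P[x [y [xP yP /eqP nxy]]].
rewrite lt0n cards_eq0; apply/eqP => S0; apply: nxy.
move: xP yP; rewrite !inE => /andP[_ /eqP <-] /andP[_ /eqP <-].
apply/(fingraph.rootP (del_adj_connect_sym S sG)).
by rewrite (@eq_connect _ _ adj) // => u v; rewrite /del_adj /= S0 !inE.
Qed.

(** Non-completeness discards the convention for complete graphs; properness makes the denominators
    positive, so they can be cleared. *)
Lemma nbeta_bound (R : realType) n (beta : R) (T : finType) (adj : rel T)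
    (X Y : {set T}) :
  nbeta_graph n beta adj -> ~ complete_graph adj ->
  X \proper [set: T] -> Y \proper [set: T] ->
  (forall x y, x \in X -> y \in Y -> ~~ adj x y) ->
  #|X|%:R * #|Y|%:R <= beta ^+ 2 * (#|~: X|%:R * #|~: Y|%:R).
Proof.
move=> [<- [[_ //]|hb]] _ pX pY noE.
have h (Z : {set T}) : Z \proper [set: T] ->
    #|T|%:R - #|Z|%:R = #|~: Z|%:R :> R /\ 0 < #|~: Z|%:R :> R.
  move=> pZ; split; first by rewrite -(cardsC Z) natrD addrC addKr.
  rewrite ltr0n lt0n cards_eq0; apply: contraTneq pZ => Z0.
  by rewrite -(setCK Z) Z0 setC0 properxx.
have [eX X0] := h _ pX; have [eY Y0] := h _ pY.
have := hb _ _ pX pY (num_edges0 noE); rewrite eX eY.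
by rewrite ler_pdivrMr // mulr_gt0.
Qed.

(** * The real inequalities of the three cases *)

Lemma ratio_transversal (R : realType) (beta c d s : R) :
  0 < beta -> 0 <= c -> 0 <= d -> d <= s + c ->
  c * c <= beta ^+ 2 * (d * d) -> c <= beta * (s + c).
Proof.
move=> b0 c0 d0 dsc h.
apply: (@le_trans _ _ (beta * d)); last by rewrite ler_pM2l.
rewrite -(@ler_pXn2r _ 2%N) ?nnegrE ?mulr_ge0 ?(ltW b0) //.
by rewrite exprMn !expr2 in h *.
Qed.

(** If [beta * (s + c) < c], then [beta < 1], so [beta * (s + u) < u] persists for all [u >= c]; the
    product over [u = a] and [u = b] contradicts the hypothesis. *)
Lemma ratio_split (R : realType) (beta a b c s : R) :
  0 < beta -> 0 < c -> 0 < s -> c <= a -> c <= b ->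
  a * b <= beta ^+ 2 * ((s + b) * (s + a)) -> c <= beta * (s + c).
Proof.
move=> b0 c0 s0 ca cb; rewrite !leNgt; apply: contra => lt_c.
have b1 : beta < 1 by nra.
have h u : c <= u -> beta * (s + u) < u by move=> cu; nra.
rewrite (_ : _ * _ = beta * (s + a) * (beta * (s + b))); last by ring.
by apply: ltr_pM; rewrite ?h //; apply: mulr_ge0; lra.
Qed.

(** Here [M] is the size of the large component. If [beta < c / (s + c)], replacing [beta] by this
    quotient leaves a polynomial inequality in [c], [s], [M]. *)
Lemma ratio_giant (R : realType) (beta c s M : R) :
  0 < beta -> 2 <= c -> 0 < s -> c + 2 <= M ->
  (c - 1 + M) * (c - 1) <= beta ^+ 2 * (s * (s + M)) -> c <= beta * (s + c).
Proof.
move=> b0 c2 s0 cM; rewrite !leNgt; apply: contra => lt_c.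
have sc0 : 0 < (s + c) ^+ 2 by apply: exprn_gt0; lra.
rewrite -(ltr_pM2r sc0).
have lt2 : (beta * (s + c)) ^+ 2 < c ^+ 2.
  by apply: ltrXn2r => //; apply: mulr_ge0; lra.
apply: (@lt_le_trans _ _ (c ^+ 2 * (s * (s + M)))).
  rewrite [ltLHS](_ : _ = (beta * (s + c)) ^+ 2 * (s * (s + M))); last by ring.
  by rewrite ltr_pM2r // mulr_gt0 //; lra.
(* Shifting [c] and [M] by their lower bounds makes every coefficient of the difference
   nonnegative. *)
pose p := c - 2; pose u := M - c - 2.
have [ec eM] : c = p + 2 /\ M = u + p + 4 by rewrite /u /p; split; ring.
have [p0 u0] : 0 <= p /\ 0 <= u by rewrite /u /p; split; lra.
rewrite ec eM -subr_ge0.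
rewrite [X in 0 <= X](_ : _ =
  u * ((p + 1) * s ^+ 2 + (p + 2) * p * s + (p + 1) * (p + 2) ^+ 2)
  + (p ^+ 2 + 3 * p + 1) * s ^+ 2 + (p + 2) * (3 * p ^+ 2 + 8 * p + 2) * s
  + (p + 1) * (2 * p + 5) * (p + 2) ^+ 2); last by ring.
have s0' := ltW s0.
by repeat (apply: addr_ge0 || apply: mulr_ge0 || apply: exprn_ge0) => //; lra.
Qed.

(** * The bound on the number of components, and toughness *)

Lemma num_comp_bound (R : realType) (beta : R) (n : nat) (T : finType)
    (adj : rel T) (S : {set T}) :
  simple_graph adj -> 0 < beta -> connected_graph adj ->
  nbeta_graph n beta adj -> disconnects adj S ->
  (num_comp adj S)%:R <= beta * (#|S|%:R + (num_comp adj S)%:R).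
Proof.
move=> sG b0 cG nb dS.
have nc := disconnects_not_complete sG dS.
have s0 := disconnects_gt0 sG cG dS.
move: dS; rewrite /disconnects num_compE; set P := comp_reps adj S => c2.
have bnd X Y := @nbeta_bound _ _ _ _ _ X Y nb nc.
have properT (X : {set T}) : (0 < #|~: X|)%N -> X \proper [set: T].
  by move=> h; rewrite properEcard subsetT cardsT /= -(cardsC X); lia.
have cST := cardsC S; have cPT := cardsC P.
pose a r := #|comps_of adj S [set r]|.
have sumP : (\sum_(r in P) a r)%N = #|~: S|.
  by rewrite -card_comps_of comps_of_reps.
have P_S : P \subset ~: S by apply/subsetP => x; rewrite inE => /andP[].
have lePS := subset_leq_card P_S.
have [le_m|lt_m] := leqP #|~: S| (2 * #|P|).
  apply: (@ratio_transversal _ _ _ #|~: P|%:R) => //.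
    by rewrite -natrD ler_nat; lia.
  by apply: bnd; [apply: properT; lia | apply: properT; lia | exact: reps_no_edge].
rewrite -sumP in lt_m.
have [[A sAP /andP[]]|[g gP single]] := split_or_giant (@comp_gt0 _ _ _) lt_m.
  rewrite -!card_comps_of // -/P; set X := comps_of _ _ A; set Y := comps_of _ _ _.
  move=> cX cY.
  have dXY : (#|X| + #|Y| = #|~: S|)%N.
    rewrite -sumP (big_setID A) /= (setIidPr sAP).
    by rewrite -!card_comps_of.
  have cXT := cardsC X; have cYT := cardsC Y.
  (* [X] and [Y] partition [~: S], so the complement of each is [S] together with the other. *)
  have eX : #|~: X| = (#|S| + #|Y|)%N by lia.
  have eY : #|~: Y| = (#|S| + #|X|)%N by lia.
  apply: (@ratio_split _ _ #|X|%:R #|Y|%:R); rewrite ?ler_nat ?ltr0n //; first lia.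
  rewrite -!natrD -eX -eY; apply: bnd; [apply: properT; lia | apply: properT; lia|].
  move=> x y; apply: comps_of_no_edge => //.
  by rewrite disjoint_sym disjoints_subset setDE subsetIr.
have := cardsD1 g P; rewrite gP => cP.
set Y := comps_of adj S (P :\ g).
have cY : #|Y| = #|P :\ g|.
  by rewrite card_comps_of -sum1_card; apply: eq_bigr => r /single.
have cYT := cardsC Y.
have mE : (#|~: S| = #|Y| + a g)%N.
  by rewrite -sumP (big_setD1 g) //= addnC /Y card_comps_of.
apply: (@ratio_giant _ _ _ _ (a g)%:R) => //.
- by rewrite ler_nat.
- by rewrite ltr0n.
(* From [2 * #|P| < #|~: S| = #|P| - 1 + a g] follows [#|P| + 2 <= a g]. *)
- by rewrite -natrD ler_nat; lia.
have -> : #|P|%:R - 1 = #|Y|%:R :> R by rewrite cP -cY natrD addrC addKr.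
have eY : #|~: Y| = (#|S| + a g)%N by lia.
rewrite -!natrD -mE -eY -{2}(setCK S).
apply: bnd; [apply: properT; rewrite setCK; lia | apply: properT; lia|].
by move=> x y; apply: singletons_no_edge.
Qed.

Theorem theorem4p2 (R : realType) (beta : R) (n : nat) (T : finType)
    (adj : rel T) (hT : (0 < #|T|)%N) (hG : simple_graph adj)
    (hbeta : 0 < beta) (hconn : connected_graph adj)
    (hnb : nbeta_graph n beta adj) :
  (((1 - beta) / beta)%:E <= toughness R adj)%E.
Proof.
rewrite /toughness.
(* A lower bound passes to minima and holds for the default [+oo], which covers complete graphs. *)
apply: (big_ind (fun z => ((1 - beta) / beta)%:E <= z)%E) =>
  [|x y hx hy|S /andP[_ dS]]; first exact: leey.
  by rewrite le_min hx.
have c0 : 0 < (num_comp adj S)%:R :> R by rewrite ltr0n (ltn_trans _ dS).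
rewrite lee_fin ler_pdivrMr // mulrAC ler_pdivlMr //.
by have := num_comp_bound hG hbeta hconn hnb dS; lra.
Qed.
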